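(* Let $g\in[0,1[$, $\alpha\in[0,1]$, $\ell>1$, $a,c\ge 0$ be constants with $ag^{\ell-1}<1$. For each $n$ consider a homogeneous rumor spreading process on $n$ nodes with success probabilities $p_k$ and covariance numbers $c_k$, and suppose that for all sufficiently large $n$ and all integers $u\in[n^{1-\alpha},gn]$, (i) $1-p_{n-u}\le a\left(\frac{u}{n}\right)^{\ell-1}$, and (ii) $c_{n-u}\le c\,\frac{n}{u^2}$. Suppose further that there is a constant $\tau>0$ such that, for all sufficiently large $n$, $1-p_{n-u}\le n^{-\tau}$ for all integers $1\le u\le n^{1-\alpha}$ (with $u\le n-1$). Then $\mathbb{E}[T(\lceil(1-g)n\rceil,n)]\le\log_\ell\ln n+O(1)$, and there exist constants $A',\alpha'>0$ such that $\Pr[T(\lceil(1-g)n\rceil,n)\ge\log_\ell\ln n+r]\le O(n^{-\alpha' r+A'})$ for all $r\in\mathbb{N}$.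
   Context: Homogeneous rumor spreading process on $n$ nodes: time proceeds in rounds $1,2,\dots$. Each node is informed or uninformed; informed nodes stay informed; the process starts with exactly one informed node. The process is memoryless: the joint law of the set of nodes newly informed in a round depends only on the set of nodes informed at the beginning of that round. Moreover, in any round starting with exactly $k$ informed nodes, each uninformed node becomes informed in that round with probability exactly $p_k$, a number depending only on $k$ (and on the process and $n$). The covariance number $c_k$ ($1\le k\le n-1$) is the smallest number such that, whenever a round starts with $k$ informed nodes, for any two distinct uninformed nodes $x_1,x_2$ the indicator random variables $X_1,X_2$ of the events that these nodes become informed in this round satisfy $\mathrm{Cov}[X_1,X_2]\le c_k$ (upper bounds on $c_{n-1}$ are vacuous). $T(k,m)$ (with $k\le m\le n$) denotes the number of rounds it takes, starting from a moment at which exactly $k$ nodes are informed, until at least $m$ nodes are informed. One has one process for each $n$; the constants implicit in $O(\cdot)$ are independent of $n$ and $r$, and the statements are for all sufficiently large $n$. *)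

(* Defs.v *)
From HB Require Import structures.
From mathcomp Require Import all_boot all_order all_algebra.
From mathcomp Require Import all_classical all_reals all_analysis.

Set Implicit Arguments.
Unset Strict Implicit.
Unset Printing Implicit Defensive.

Import Order.TTheory GRing.Theory Num.Theory.

Local Open Scope classical_set_scope.
Local Open Scope ring_scope.

(** [law S N] is the probability that the set of nodes newly informed in a
    round is exactly [N], when [S] is the set of nodes informed at the beginning
    of that round; [success k] is the number $p_k$. The case [S] empty never
    occurs, so nothing is required of the success probabilities there, and
    [success k] is only constrained for 1 <= k <= n - 1. *)
Record rumor_process (R : realType) (n : nat) := RumorProcess {
  law : {set 'I_n} -> {set 'I_n} -> R ;
  success : nat -> R ;
  law_ge0 : forall S N, 0 <= law S N ;
  law_sum1 : forall S, \sum_(N : {set 'I_n}) law S N = 1 ;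
  law_new : forall S N, law S N != 0 -> N \subset ~: S ;
  law_homogeneous : forall (S : {set 'I_n}) (x : 'I_n),
    (0 < #|S|)%N -> x \notin S ->
    \sum_(N : {set 'I_n} | x \in N) law S N = success #|S| }.

Definition round_mean (R : realType) (n : nat) (K : rumor_process R n)
    (S : {set 'I_n}) (X : {set 'I_n} -> R) : R :=
  \sum_(N : {set 'I_n}) law K S N * X N.

Definition round_cov (R : realType) (n : nat) (K : rumor_process R n)
    (S : {set 'I_n}) (X Y : {set 'I_n} -> R) : R :=
  round_mean K S (fun N => (X N - round_mean K S X) * (Y N - round_mean K S Y)).

Definition newly_informed (R : realType) (n : nat) (x : 'I_n) :
  {set 'I_n} -> R := fun N => (x \in N)%:R.

(** The covariance number $c_k$, i.e. the least upper bound of the covariances.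
    For 1 <= k <= n - 2 it is a maximum over a nonempty finite set; for
    k = n - 1 there are no two distinct uninformed nodes and its value is -oo,
    so that every upper bound on it holds. *)
Definition cov_number (R : realType) (n : nat) (K : rumor_process R n)
    (k : nat) : \bar R :=
  ereal_sup [set v | exists (S : {set 'I_n}) (x1 x2 : 'I_n),
    [/\ #|S| = k, x1 \notin S, x2 \notin S, x1 != x2 &
        v = (round_cov K S (newly_informed R x1) (newly_informed R x2))%:E]].

(** [I t w] is the set of informed nodes after [t] rounds. The run starts from
    an arbitrary, possibly random, set of exactly [k] informed nodes; [k = 1]
    gives the whole rumor spreading process. The last clause says that, given
    the whole past, the newly informed set has law [law K (I t)]. *)
Definition run_from (R : realType) (n : nat) (K : rumor_process R n) (k : nat)
    (d : measure_display) (Omega : measurableType d) (P : probability Omega R)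
    (I : nat -> Omega -> {set 'I_n}) : Prop :=
  [/\ forall t S, measurable [set w | I t w = S],
      P [set w | #|I 0%N w| = k] = 1%E,
      forall t w, I t w \subset I t.+1 w &
      forall (t : nat) (s : nat -> {set 'I_n}) (N : {set 'I_n}),
        let past := [set w | forall i, (i <= t)%N -> I i w = s i] in
        P (past `&` [set w | I t.+1 w :\: I t w = N])
          = (P past * (law K (s t) N)%:E)%E].

(** For a run [I] started with [k] informed nodes, this is $T(k,m)$; it is +oo
    if [m] informed nodes are never reached. *)
Definition spread_time (R : realType) (n : nat) (Omega : Type)
    (I : nat -> Omega -> {set 'I_n}) (m : nat) (w : Omega) : \bar R :=
  ereal_inf [set (t%:R : R)%:E | t in [set t : nat | (m <= #|I t w|)%N]].

Definition natceil (R : realType) (x : R) : nat := `|Num.ceil x|%N.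

(* Main.v *)
Require Import Defs.
From HB Require Import structures.
From mathcomp Require Import all_boot all_order all_algebra.
From mathcomp Require Import all_classical all_reals all_analysis.
From mathcomp Require Import measurable_realfun ring lra zify.

(** Let u be the number of uninformed nodes. In a round its mean becomes
    u (1 - p) <= a n (u/n)^l, and the covariance bound makes its variance at
    most (1 + c) n. Fix kappa with b = kappa^(l-1) > a and kappa g < 1. The
    fractions x_j = exp(- lam l^j) / kappa satisfy x_(j+1) = b x_j^l, so by
    Chebyshev u <= n x_j yields u > n x_(j+1) with probability at most
    q = n^(-eps), as long as x_(j+1) is at least a small negative power of n.
    The last such index J is log_l (ln n) + O(1), and once u <= n x_J even
    1 - p <= q holds, so that Markov's inequality finishes. As u never increases,
    a failed round costs only the factor q: the probability of being incomplete
    after J + s rounds is at most n 2^(J+s) q^s, which is n^(2 - (eps/2) s) for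
    large n. *)

Import Order.TTheory GRing.Theory Num.Theory.

Local Open Scope classical_set_scope.
Local Open Scope ring_scope.

(** * One round: moments of the number of uninformed nodes, and their iteration *)

Section OneRound.
Context {R : realType} {n : nat} (K : rumor_process R n).
Implicit Types S N : {set 'I_n}.

Lemma card_sum_mem (A : {set 'I_n}) : #|A| = (\sum_(x : 'I_n) (x \in A))%N.
Proof. by rewrite -sum1_card big_mkcond; apply: eq_bigr => x _; case: ifP. Qed.

Lemma card_uninformed S N :
  #|~: (S :|: N)|%:R = \sum_(x | x \notin S) (x \notin N)%:R :> R.
Proof.
rewrite card_sum_mem natr_sum [RHS]big_mkcond; apply: eq_bigr => x _.
by rewrite finset.in_setC finset.in_setU negb_or; case: (x \in S).
Qed.

Lemma card_uninformed_mono S N : (#|~: (S :|: N)| <= #|~: S|)%N.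
Proof. by apply: subset_leq_card; rewrite finset.setCS finset.subsetUl. Qed.

Lemma card_informed S : (#|~: S| < n)%N -> (0 < #|S|)%N.
Proof. by move=> h; have := cardsC S; rewrite card_ord; lia. Qed.

Lemma card_informedE S : #|S| = (n - #|~: S|)%N.
Proof. by have := cardsC S; rewrite card_ord; lia. Qed.

Lemma round_mean_cst S (k : R) : round_mean K S (fun=> k) = k.
Proof. by rewrite /round_mean -mulr_suml law_sum1 mul1r. Qed.

Lemma round_meanD S X Y :
  round_mean K S (fun N => X N + Y N) = round_mean K S X + round_mean K S Y.
Proof. by rewrite -big_split; apply: eq_bigr => N _; rewrite mulrDr. Qed.

Lemma round_meanZ S (k : R) X :
  round_mean K S (fun N => k * X N) = k * round_mean K S X.
Proof. by rewrite mulr_sumr; apply: eq_bigr => N _; rewrite mulrCA. Qed.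

Lemma round_mean_sum S (T : finType) (Q : pred T) (X : T -> {set 'I_n} -> R) :
  round_mean K S (fun N => \sum_(x | Q x) X x N)
  = \sum_(x | Q x) round_mean K S (X x).
Proof. by rewrite exchange_big; apply: eq_bigr => N _; rewrite mulr_sumr. Qed.

Lemma le_round_mean S X Y : (forall N, X N <= Y N) ->
  round_mean K S X <= round_mean K S Y.
Proof.
by move=> h; apply: ler_sum => N _; apply: ler_wpM2l => //; exact: law_ge0.
Qed.

Lemma eq_round_mean S X Y : X =1 Y -> round_mean K S X = round_mean K S Y.
Proof. by move=> h; apply: eq_bigr => N _; rewrite h. Qed.

Lemma round_mean_newly S x : (0 < #|S|)%N -> x \notin S ->
  round_mean K S (newly_informed R x) = success K #|S|.
Proof.
move=> S0 xS; rewrite -(law_homogeneous K S0 xS) [RHS]big_mkcond.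
by apply: eq_bigr => N _; rewrite /newly_informed; case: ifP => _;
  rewrite ?mulr1 ?mulr0.
Qed.

Lemma success_itv S x : (0 < #|S|)%N -> x \notin S -> 0 <= success K #|S| <= 1.
Proof.
move=> S0 xS; rewrite -(round_mean_newly S x S0 xS); apply/andP; split.
  rewrite -[leLHS](round_mean_cst S); apply: le_round_mean => N.
  by rewrite ler0n.
rewrite -[leRHS](round_mean_cst S); apply: le_round_mean => N.
by rewrite /newly_informed; case: (x \in N) => //=.
Qed.

Lemma mean_uninformed S : (0 < #|S|)%N ->
  round_mean K S (fun N => #|~: (S :|: N)|%:R)
  = #|~: S|%:R * (1 - success K #|S|).
Proof.
move=> S0; rewrite (eq_round_mean _ _ _ (card_uninformed S)) round_mean_sum.
rewrite mulr_natl -sumr_const; apply: eq_big => [x|x xS].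
  by rewrite finset.in_setC.
rewrite -(round_mean_newly _ _ S0 xS).
rewrite -[in RHS](round_mean_cst S 1) -mulN1r -round_meanZ -round_meanD.
by apply: eq_round_mean => N; rewrite /newly_informed; case: (x \in N) => /=; ring.
Qed.

Lemma cov_newly_diag S x : (0 < #|S|)%N -> x \notin S ->
  round_cov K S (newly_informed R x) (newly_informed R x) <= 1.
Proof.
move=> S0 xS; have /andP[p0 p1] := success_itv _ _ S0 xS.
rewrite -[leRHS](round_mean_cst S); apply: le_round_mean => N.
rewrite round_mean_newly // /newly_informed; case: (x \in N) => /=; nra.
Qed.

Lemma cov_newly_le S (x1 x2 : 'I_n) (v : R) :
  (cov_number K #|S| <= v%:E)%E -> x1 \notin S -> x2 \notin S -> x1 != x2 ->
  round_cov K S (newly_informed R x1) (newly_informed R x2) <= v.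
Proof.
move=> hv x1S x2S x12; rewrite -lee_fin; apply: le_trans hv.
by apply: ereal_sup_ubound; exists S, x1, x2.
Qed.

(** The variance of a sum of indicators is the sum of all covariances: the diagonal ones are at most
    1, the others at most [v]. *)
Lemma var_uninformed S (v : R) : (0 < #|S|)%N -> 0 <= v ->
  (cov_number K #|S| <= v%:E)%E ->
  round_mean K S (fun N =>
    (#|~: (S :|: N)|%:R - #|~: S|%:R * (1 - success K #|S|)) ^+ 2)
  <= #|~: S|%:R + #|~: S|%:R ^+ 2 * v.
Proof.
move=> S0 v0 hv.
(* Staying uninformed is complementary to being newly informed, so both factors of each product
   change sign and covariances of [newly_informed] appear. *)
have E N : (#|~: (S :|: N)|%:R - #|~: S|%:R * (1 - success K #|S|)) ^+ 2
  = \sum_(x | x \notin S) \sum_(y | y \notin S)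
    (newly_informed R x N - success K #|S|)
    * (newly_informed R y N - success K #|S|).
  rewrite card_uninformed mulr_natl -sumr_const.
  rewrite [X in _ - X](eq_bigl (fun x => x \notin S)); last first.
    by move=> x; rewrite finset.in_setC.
  rewrite -sumrB expr2 big_distrlr; apply: eq_bigr => x _.
  apply: eq_bigr => y _; rewrite /newly_informed.
  by case: (x \in N); case: (y \in N) => /=; ring.
rewrite (eq_round_mean _ _ _ E) round_mean_sum.
have -> : #|~: S|%:R + #|~: S|%:R ^+ 2 * v
  = \sum_(x | x \notin S) (1 + #|~: S|%:R * v).
  rewrite (eq_bigl (fun x => x \in ~: S)) => [|x]; last by rewrite finset.in_setC.
  by rewrite sumr_const -mulr_natl; ring.
apply: ler_sum => x xS; rewrite round_mean_sum (bigD1 x) //=.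
have cE y : y \notin S -> round_mean K S (fun N =>
    (newly_informed R x N - success K #|S|)
    * (newly_informed R y N - success K #|S|))
    = round_cov K S (newly_informed R x) (newly_informed R y).
  by move=> yS; rewrite /round_cov !round_mean_newly.
apply: lerD; first by rewrite cE //; exact: cov_newly_diag.
apply: (@le_trans _ _ (\sum_(y | (y \notin S) && (y != x)) v)).
  apply: ler_sum => y /andP[yS yx]; rewrite cE //.
  by apply: cov_newly_le; rewrite // eq_sym.
(* Since [0 <= v], the missing diagonal entry can be added to the row. *)
rewrite mulr_natl -sumr_const [leRHS]big_mkcond [leLHS]big_mkcond.
by apply: ler_sum => y _; rewrite finset.in_setC;
  case: (y \notin S); case: (y != x).
Qed.

(** Exceeding [m] forces a deviation of more than [D] from the mean. Only an upper bound on the mean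
    enters, which is all that bounds on [1 - success] can supply. *)
Lemma round_chebyshev S (v D m : R) : (0 < #|S|)%N -> 0 <= v -> 0 < D ->
  (cov_number K #|S| <= v%:E)%E ->
  #|~: S|%:R * (1 - success K #|S|) + D <= m ->
  round_mean K S (fun N => (m < #|~: (S :|: N)|%:R)%R%:R)
  <= (#|~: S|%:R + #|~: S|%:R ^+ 2 * v) / D ^+ 2.
Proof.
move=> S0 v0 D0 hv hm; rewrite ler_pdivlMr ?exprn_gt0 // mulrC.
apply: le_trans (var_uninformed _ _ S0 v0 hv); rewrite -round_meanZ.
apply: le_round_mean => N; case: ltP => /= h; last by rewrite mulr0 sqr_ge0.
by rewrite mulr1 lerXn2r ?nnegrE //; lra.
Qed.

Lemma round_markov S (m : R) : (0 < #|S|)%N -> 0 < m ->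
  round_mean K S (fun N => (m < #|~: (S :|: N)|%:R)%R%:R)
  <= #|~: S|%:R * (1 - success K #|S|) / m.
Proof.
move=> S0 m0; rewrite ler_pdivlMr // mulrC -mean_uninformed // -round_meanZ.
by apply: le_round_mean => N; case: ltP => /= h; rewrite ?mulr1 ?mulr0 // ltW.
Qed.

(** Backward equation of the Markov chain of informed sets. It involves the round laws alone, so the
    estimates can be made before any probability space appears. *)
Fixpoint incomplete_prob (t : nat) (S : {set 'I_n}) : R :=
  if t is t'.+1 then round_mean K S (fun N => incomplete_prob t' (S :|: N))
  else (0 < #|~: S|)%N%:R.

(** First-moment argument: the number of uninformed nodes never increases, so the bound [q] stays
    available, and the mean of this number shrinks by a factor [q] per round. *)
Lemma incomplete_prob_end (m q : R) t S : 0 <= q ->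
  (forall S', (#|~: S'| < n)%N -> (0 < #|~: S'|)%N -> #|~: S'|%:R <= m ->
    1 - success K #|S'| <= q) ->
  (#|~: S| < n)%N -> #|~: S|%:R <= m ->
  incomplete_prob t S <= #|~: S|%:R * q ^+ t.
Proof.
move=> q0 hq; elim: t S => [|t IH] S Sn Sm /=.
  by rewrite expr0 mulr1 ler_nat; case: (#|~: S|).
apply: (@le_trans _ _ (round_mean K S (fun N => q ^+ t * #|~: (S :|: N)|%:R))).
  apply: le_round_mean => N; rewrite mulrC; apply: IH.
    exact: leq_ltn_trans (card_uninformed_mono _ _) Sn.
  by apply: le_trans Sm; rewrite ler_nat card_uninformed_mono.
rewrite round_meanZ mean_uninformed ?card_informed //.
have [->|u0] := posnP #|~: S|; first by rewrite !mul0r mulr0.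
rewrite exprS mulrCA; apply: ler_wpM2l => //.
rewrite mulrC; apply: ler_wpM2r; first exact: exprn_ge0.
exact: hq.
Qed.

(* Rounds that fail to reach the next threshold leave the process where it is;
   each of them costs a factor [q], and [2 ^+ t] counts the patterns of
   failures. *)
Lemma incomplete_prob_thresholds (G q : R) (m : nat -> R) (J : nat) :
  G < n%:R -> 0 <= q <= 1 ->
  (forall S, #|~: S|%:R <= G -> (0 < #|~: S|)%N -> #|~: S|%:R <= m 0%N ->
    1 - success K #|S| <= q) ->
  (forall d S, (d < J)%N -> #|~: S|%:R <= G -> #|~: S|%:R <= m d.+1 ->
    round_mean K S (fun N => (m d < #|~: (S :|: N)|%:R)%R%:R) <= q) ->
  forall t d S, (d <= J)%N -> #|~: S|%:R <= G -> #|~: S|%:R <= m d ->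
  incomplete_prob t S * q ^+ d <= n%:R * (2 * q) ^+ t.
Proof.
(* Levels are counted down: [d] successes are still needed to reach [m 0]. The factor [q ^+ d] on
   the left stands for an exponent [t - d] on the right. *)
move=> Gn /andP[q0 q1] hend hstep; elim=> [|t IH] d S dJ SG Sm.
  rewrite expr0 mulr1 /=; apply: (@le_trans _ _ 1).
    by apply: mulr_ile1; rewrite ?exprn_ge0 ?exprn_ile1 //; case: (0 < _)%N.
  by rewrite ler1n -(ltr_nat R); apply: le_lt_trans Gn; apply: le_trans SG.
have Sn : (#|~: S| < n)%N by rewrite -(ltr_nat R); exact: le_lt_trans Gn.
case: d dJ Sm => [|d] dJ Sm.
  rewrite expr0 mulr1; apply: (@le_trans _ _ (#|~: S|%:R * q ^+ t.+1)).
    apply: (@incomplete_prob_end (Num.min G (m 0%N))) => // [S' _ S'0|].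
      by rewrite le_min => /andP[S'G S'm]; exact: hend.
    by rewrite le_min SG.
  rewrite exprMn; apply: ler_pM; rewrite ?exprn_ge0 ?ler_nat //; first exact: ltnW.
  by rewrite ler_peMl ?exprn_ge0 // exprn_ege1 // ler1n.
have A0 : 0 <= n%:R * (2 * q) ^+ t by rewrite mulr_ge0 ?exprn_ge0 // mulr_ge0.
rewrite /= mulrC -round_meanZ.
(* After a success the induction hypothesis at level [d] leaves one factor [q] unspent. After a
   failure there is no such gain, but failures have probability at most [q]. Together this gives
   [2 * q]. *)
apply: (@le_trans _ _ (round_mean K S (fun N => n%:R * (2 * q) ^+ t *
    (q + (m d < #|~: (S :|: N)|%:R)%R%:R)))).
  apply: le_round_mean => N; rewrite mulrC.
  have le_u : #|~: (S :|: N)|%:R <= #|~: S|%:R :> R.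
    by rewrite ler_nat card_uninformed_mono.
  have SNG := le_trans le_u SG.
  case: ltP => h /=.
    apply: le_trans (IH _ _ dJ SNG (le_trans le_u Sm)) _.
    by apply: ler_peMr => //; lra.
  rewrite addr0 exprSr mulrA; apply: ler_wpM2r => //.
  exact: IH (ltnW dJ) SNG h.
rewrite round_meanZ round_meanD round_mean_cst exprSr mulrA.
by apply: ler_wpM2l => //; have := hstep d S dJ SG Sm; lra.
Qed.

End OneRound.

(** * Runs: Markov property and distribution of the state after t rounds *)

Lemma total_probability {R : realType} {d : measure_display}
    {Omega : measurableType d} (P : probability Omega R) {F : finType}
    (f : Omega -> F) (A : set Omega) :
  (forall x, measurable [set w | f w = x]) -> measurable A ->
  P A = (\sum_(x : F) P (A `&` [set w | f w = x]))%E.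
Proof.
move=> mf mA.
have {1}-> : A = \bigcup_(x in [set` index_enum F]) (A `&` [set w | f w = x]).
  apply/seteqP; split=> [w Aw|w [x _ []]//].
  by exists (f w); rewrite //= mem_index_enum.
rewrite measure_fin_bigcup //.
- by rewrite -fsbig_seq // index_enum_uniq.
- by move=> x y _ _ [w [[_ <-] [_ <-]]].
- by move=> x _; exact: measurableI.
Qed.

Section Run.
Context {R : realType} {n : nat} {K : rumor_process R n} {k : nat}.
Context {d : measure_display} {Omega : measurableType d}.
Context {P : probability Omega R} {I : nat -> Omega -> {set 'I_n}}.
Hypothesis HI : run_from K k P I.

Let mI t S : measurable [set w | I t w = S].
Proof. by case: HI. Qed.

Let monoI t w : I t w \subset I t.+1 w.
Proof. by case: HI. Qed.

Lemma measurable_informed t (Q : {set 'I_n} -> Prop) :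
  measurable [set w | Q (I t w)].
Proof.
have -> : [set w | Q (I t w)] = \bigcup_(S in Q) [set w | I t w = S].
  by apply/seteqP; split=> [w Qw|w [S QS /= ->]//]; exists (I t w).
by apply: fin_bigcup_measurable => // S _.
Qed.

Lemma measurable_newly t N : measurable [set w | I t.+1 w :\: I t w = N].
Proof.
have -> : [set w | I t.+1 w :\: I t w = N] =
    \bigcup_(S in [set: {set 'I_n}]) ([set w | I t w = S] `&`
      [set w | I t.+1 w :\: S = N]).
  by apply/seteqP; split=> [w Qw|w [S _ [/= ->]]//]; exists (I t w).
apply: fin_bigcup_measurable => // S _; apply: measurableI => //.
exact: (measurable_informed t.+1 (fun S' => S' :\: S = N)).
Qed.

Lemma informed_add t w (S N : {set 'I_n}) :
  I t w = S -> I t.+1 w :\: I t w = N -> I t.+1 w = S :|: N.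
Proof.
move=> <- <-; apply/finset.setP => x; rewrite !inE.
by have := fintype.subsetP (monoI t w) x; case: (x \in I t w) => //= ->.
Qed.

Let mpast m t (s : nat -> {set 'I_n}) :
  measurable [set w | forall i, (m <= i <= t)%N -> I i w = s i].
Proof.
have -> : [set w | forall i, (m <= i <= t)%N -> I i w = s i] =
    \bigcap_(i in [set` index_iota m t.+1]) [set w | I i w = s i].
  by apply/seteqP; split=> w h i /=; have := h i; rewrite /= mem_index_iota.
by apply: fin_bigcap_measurable => //; exact: finite_seq.
Qed.

(** The definition of a run conditions on the whole past. Summing over the values of the oldest
    constrained state removes one constraint at a time. *)
Lemma run_step_recent m t (s : nat -> {set 'I_n}) (N : {set 'I_n}) :
  (m <= t)%N ->
  let recent := [set w | forall i, (m <= i <= t)%N -> I i w = s i] in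
  P (recent `&` [set w | I t.+1 w :\: I t w = N])
    = (P recent * (law K (s t) N)%:E)%E.
Proof.
elim: m s => [|m IH] s mt /=; first by case: HI => _ _ _ /(_ t s N).
pose s' S i := if i == m then S else s i.
have E S : [set w | forall i, (m < i <= t)%N -> I i w = s i]
    `&` [set w | I m w = S] =
    [set w | forall i, (m <= i <= t)%N -> I i w = s' S i].
  apply/seteqP; split=> [w [h1 h2] i|w h].
    rewrite /s' leq_eqVlt eq_sym; case: eqP => [->//|_] /=; exact: h1.
  split=> [i /andP[mi it]|] /=.
    have := h i; rewrite /s' it ltnW // gtn_eqF //; exact.
  by have := h m; rewrite /s' leqnn ltnW // eqxx; exact.
have mN := measurable_newly t N.
rewrite (total_probability P (I m)) //; last exact: measurableI.
rewrite [X in (_ = X * _)%E](total_probability P (I m)) //.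
(* As [m < t], changing the path at [m] keeps [s t], so every term carries the same factor
   [law K (s t) N]. *)
rewrite ge0_sume_distrl //; apply: eq_bigr => S _.
by rewrite setIAC !E IH ?(ltnW mt) // /s' gtn_eqF.
Qed.

Lemma run_step t (S N : {set 'I_n}) :
  P ([set w | I t w = S] `&` [set w | I t.+1 w :\: I t w = N])
    = (P [set w | I t w = S] * (law K S N)%:E)%E.
Proof.
have /= := @run_step_recent t t (fun=> S) N (leqnn t).
suff -> : [set w | forall i, (t <= i <= t)%N -> I i w = S]
  = [set w | I t w = S] by [].
apply/seteqP; split=> w /= h; first by apply: h; rewrite leqnn.
by move=> i; rewrite -eqn_leq => /eqP <-.
Qed.

Definition state_prob t S : R := fine (P [set w | I t w = S]).

Lemma state_probE t S : (state_prob t S)%:E = P [set w | I t w = S].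
Proof. by rewrite /state_prob fineK // fin_num_measure. Qed.

(** Forward equation of the chain, obtained by splitting over the previous state and the newly
    informed set. *)
Lemma state_probS t S' : state_prob t.+1 S' =
  \sum_S \sum_(N | S' == S :|: N) state_prob t S * law K S N.
Proof.
apply: EFin_inj; rewrite state_probE (total_probability P (I t)) // -sumEFin.
apply: eq_bigr => S _; rewrite -sumEFin [RHS]big_mkcond.
pose new := fun w => I t.+1 w :\: I t w.
rewrite (total_probability P new); last 2 first.
- by move=> N; exact: measurable_newly.
- exact: measurableI.
apply: eq_bigr => N _; case: eqP => [->|ne].
  rewrite EFinM state_probE -run_step; congr (P _); apply/seteqP.
  split=> [w [[_ ?] ?]|w [h1 h2]] //; split=> //; split=> //.
  exact: (informed_add _ _ _ _ h1 h2).
suff -> : [set w | I t.+1 w = S'] `&` [set w | I t w = S] `&`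
  [set w | new w = N] = set0 by rewrite measure0.
apply/seteqP; split=> // w [[/= h0 h1] h2]; apply: ne.
by rewrite -h0; exact: (informed_add _ _ _ _ h1 h2).
Qed.

Lemma mean_state_probS t (phi : {set 'I_n} -> R) :
  \sum_S state_prob t.+1 S * phi S =
  \sum_S state_prob t S * round_mean K S (fun N => phi (S :|: N)).
Proof.
under eq_bigr => S' _ do rewrite state_probS mulr_suml.
rewrite exchange_big; apply: eq_bigr => S _; rewrite mulr_sumr.
under eq_bigr => S' _ do rewrite mulr_suml big_mkcond.
rewrite exchange_big; apply: eq_bigr => N _.
by rewrite -big_mkcond big_pred1_eq mulrA.
Qed.

(** Duality of the forward and backward equations: each step moves one round from [incomplete_prob]
    to the state distribution. *)
Lemma mean_incomplete_prob t j :
  \sum_S state_prob j S * incomplete_prob K t S =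
  \sum_S state_prob (t + j) S * (0 < #|~: S|)%N%:R.
Proof.
elim: t j => [//|t IH] j; rewrite addSnnS -IH.
by rewrite (mean_state_probS j (incomplete_prob K t)).
Qed.

Lemma sum_state_prob t : \sum_S state_prob t S = 1.
Proof.
apply: EFin_inj; rewrite -sumEFin -(probability_setT P).
rewrite (total_probability P (I t)) //; apply: eq_bigr => S _.
by rewrite setTI state_probE.
Qed.

(** The initial distribution is concentrated on sets of size [k], so a bound valid for each of them
    survives averaging over a random start. *)
Lemma incomplete_le t (b : R) :
  (forall S : {set 'I_n}, #|S| = k -> incomplete_prob K t S <= b) ->
  (P [set w | (0 < #|~: I t w|)%N] <= b%:E)%E.
Proof.
move=> hb.
have <- : (\sum_S state_prob t S * (0 < #|~: S|)%N%:R)%:E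
    = P [set w | (0 < #|~: I t w|)%N].
  rewrite (total_probability P (I t)) //; last first.
    exact: (measurable_informed t (fun S => (0 < #|~: S|)%N)).
  rewrite -sumEFin; apply: eq_bigr => S _; case: ltnP => h /=.
    rewrite mulr1 state_probE; congr (P _).
    by apply/seteqP; split=> [w /= E|w []//]; rewrite E.
  rewrite mulr0 (_ : _ `&` _ = set0) ?measure0 //.
  by apply/seteqP; split=> // w [/= + E]; rewrite E ltnNge h.
rewrite lee_fin -(addn0 t) -mean_incomplete_prob -[leRHS]mul1r.
rewrite -(sum_state_prob 0) mulr_suml; apply: ler_sum => S _.
have p0 : 0 <= state_prob 0 S by rewrite fine_ge0.
have [Sk|Sk] := eqVneq #|S| k; first by apply: ler_wpM2l => //; exact: hb.
suff -> : state_prob 0 S = 0 by rewrite !mul0r.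
apply: EFin_inj; rewrite state_probE; apply/eqP; rewrite eq_le measure_ge0 andbT.
have mk := measurable_informed 0 (fun S => #|S| = k).
have k1 : P [set w | #|I 0%N w| = k] = 1%E by case: HI.
have k0 : P (~` [set w | #|I 0%N w| = k]) = 0%E.
  by rewrite probability_setC // k1 subee.
rewrite -[leRHS]k0.
apply: le_measure; rewrite ?inE //; first exact: measurableC.
by move=> w /= ->; exact/eqP.
Qed.

(** * The spread time: sum of tail events, measurability, mean and tail *)

Lemma uninformed_anti (i j : nat) w :
  (i <= j)%N -> (#|~: I j w| <= #|~: I i w|)%N.
Proof.
move=> ij; rewrite -(subnK ij); elim: (j - i)%N => // m IH.
apply: leq_trans IH; apply: subset_leq_card.
by rewrite finset.setCS addSn.
Qed.

Lemma informed_full t w : (n <= #|I t w|)%N = (#|~: I t w| == 0)%N.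
Proof. by have := cardsC (I t w); rewrite card_ord; lia. Qed.

Lemma spread_time_ge_incomplete t (v : \bar R) w : ((t%:R : R)%:E < v)%E ->
  (v <= spread_time R I n w)%E -> (0 < #|~: I t w|)%N.
Proof.
move=> tv vT; rewrite lt0n -informed_full; apply/negP => h.
have : (spread_time R I n w <= (t%:R : R)%:E)%E.
  by apply: ereal_inf_lbound; exists t.
by move=> /(le_trans vT); rewrite leNgt tv.
Qed.

(** By monotonicity the incomplete times form an initial segment, whose length is the spread time.
    The series form gives both measurability and the mean. *)
Lemma spread_timeE w : spread_time R I n w =
  (\sum_(0 <= t <oo) (\1_[set w | (0 < #|~: I t w|)%N] w)%:E)%E.
Proof.
have [[t0 ft0]|nf] := pselect (exists t, (n <= #|I t w|)%N).
  have ex : exists t, (n <= #|I t w|)%N by exists t0.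
  case: (ex_minnP ex) => t ft tmin.
  have -> : spread_time R I n w = (t%:R : R)%:E.
    apply/eqP; rewrite eq_le; apply/andP; split.
      by apply: ereal_inf_lbound; exists t.
    by apply: le_ereal_inf_tmp => _ [j /= fj <-]; rewrite lee_fin ler_nat tmin.
  rewrite (nneseries_split _ t) // add0n eseries0 ?adde0.
    rewrite sumEFin (eq_big_nat _ _ (F2 := fun=> 1)) => [|i /andP[_ it]].
      by rewrite big_mkord sumr_const card_ord.
    rewrite indicE mem_set //= lt0n -informed_full; apply/negP => /tmin.
    by rewrite leqNgt it.
  move=> j tj _; rewrite indicE memNset //=; apply/negP; rewrite -leqNgt.
  by apply: leq_trans (uninformed_anti _ _ w tj) _; rewrite leqn0 -informed_full.
have -> : spread_time R I n w = +oo%E.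
  rewrite /spread_time (_ : [set _ | _ in _] = set0) ?ereal_inf0 //.
  by apply/seteqP; split=> // v [t ft _]; apply: nf; exists t.
(* If the process never completes, every term is 1 and the partial sums exceed any real number. *)
rewrite (eq_eseriesr (g := fun=> 1%E)) => [|i _].
  apply/esym/eqyP => r r0; pose j := (Num.truncn r).+1.
  apply: (@le_trans _ _ (j%:R : R)%:E).
    by rewrite lee_fin ltW // truncnS_gt.
  rewrite (nneseries_split _ j) // sumEFin add0n big_mkord sumr_const card_ord.
  by apply: leeDl; apply: nneseries_ge0.
rewrite indicE mem_set //= lt0n -informed_full; apply/negP => h.
by apply: nf; exists i.
Qed.

Let m1 t : measurable [set w | (0 < #|~: I t w|)%N].
Proof. exact: (measurable_informed t (fun S => (0 < #|~: S|)%N)). Qed.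

Lemma measurable_spread_time :
  measurable_fun [set: Omega] (spread_time R I n : Omega -> \bar R).
Proof.
rewrite (_ : spread_time R I n = fun w =>
  (\sum_(0 <= t <oo) (\1_[set w | (0 < #|~: I t w|)%N] w)%:E)%E).
  apply: ge0_emeasurable_sum => // t _.
  exact/measurable_EFinP/measurable_indic.
by apply/funext => w; exact: spread_timeE.
Qed.

Lemma mean_spread_time : (\int[P]_w spread_time R I n w =
  \sum_(0 <= t <oo) P [set w | (0 < #|~: I t w|)%N])%E.
Proof.
under eq_integral do rewrite spread_timeE.
rewrite integral_nneseries //.
  by apply: eq_eseriesr => t _; rewrite integral_indic // setIT.
by move=> t; exact/measurable_EFinP/measurable_indic.
Qed.

Lemma spread_time_tail t (v : \bar R) : ((t%:R : R)%:E < v)%E ->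
  (P [set w | v <= spread_time R I n w] <= P [set w | (0 < #|~: I t w|)%N])%E.
Proof.
move=> tv; apply: le_measure; rewrite ?inE //; last first.
  by move=> w; exact: spread_time_ge_incomplete.
rewrite -[X in measurable X]setTI.
exact: (emeasurable_fun_c_infty measurableT measurable_spread_time).
Qed.

End Run.

(** * Doubly exponential thresholds and the rounds that cross them *)

Section Thresholds.
Context {R : realType} (kappa lam l : R).
Hypotheses (kappa0 : 0 < kappa) (lam0 : 0 < lam) (l1 : 1 < l).

(* The iterates of [x |-> kappa `^ (l - 1) * x `^ l], in closed form. *)
Definition fraction_bound (j : nat) : R := expR (- (lam * l ^+ j)) / kappa.

Lemma fraction_bound_gt0 j : 0 < fraction_bound j.
Proof. by rewrite divr_gt0 ?expR_gt0. Qed.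

(** Rescaling by [kappa] turns the recursion into [y |-> y^l], which multiplies the exponent of
    [expR] by [l]. *)
Lemma fraction_boundS j :
  kappa `^ (l - 1) * fraction_bound j `^ l = fraction_bound j.+1.
Proof.
have kl : kappa `^ l != 0 by rewrite gt_eqF // powR_gt0.
have h : fraction_bound j `^ l * kappa `^ l = expR (- (lam * l ^+ j.+1)).
  rewrite -powRM ?ltW ?fraction_bound_gt0 // divfK ?gt_eqF //.
  by rewrite /powR gt_eqF ?expR_gt0 // expRK exprSr; congr expR; ring.
have l0 : 0 < l by exact: lt_trans ltr01 _.
rewrite /fraction_bound -h -[in RHS](mulr_powRB1 (ltW kappa0) l0).
by field; rewrite gt_eqF.
Qed.

Lemma fraction_bound_anti i j : (i <= j)%N ->
  fraction_bound j <= fraction_bound i.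
Proof.
move=> ij; rewrite ler_pM2r ?invr_gt0 // ler_expR lerN2 ler_pM2l //.
by apply: ler_weXn2l => //; exact: ltW.
Qed.

(** Chebyshev's inequality serves from n^(1 - alpha) uninformed nodes on, Markov's below. The lower
    bound [M] on the thresholds makes [q] independent of [j]. *)
Lemma thresholds_step (n : nat) (K : rumor_process R n)
    (g alpha a c tau q M : R) (j : nat) (S : {set 'I_n}) :
  (0 < n)%N -> g < 1 -> 0 <= a < kappa `^ (l - 1) -> 0 <= c ->
  (forall u : nat, n%:R `^ (1 - alpha) <= u%:R <= g * n%:R ->
    1 - success K (n - u)%N <= a * (u%:R / n%:R) `^ (l - 1)) ->
  (forall u : nat, n%:R `^ (1 - alpha) <= u%:R <= g * n%:R ->
    (cov_number K (n - u)%N <= (c * (n%:R / u%:R ^+ 2))%:E)%E) ->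
  (forall u : nat, (1 <= u <= n - 1)%N -> u%:R <= n%:R `^ (1 - alpha) ->
    1 - success K (n - u)%N <= n%:R `^ (- tau)) ->
  0 < M <= fraction_bound j.+1 ->
  (1 + c) / (n%:R * (1 - a / kappa `^ (l - 1)) ^+ 2 * M ^+ 2) <= q ->
  n%:R `^ (- tau) / M <= q ->
  #|~: S|%:R <= g * n%:R -> #|~: S|%:R <= n%:R * fraction_bound j ->
  round_mean K S (fun N =>
    (n%:R * fraction_bound j.+1 < #|~: (S :|: N)|%:R)%R%:R) <= q.
Proof.
move=> n0 g1 /andP[a0 ab] c0 hs hc he /andP[M0 Mx] hq1 hq2 SG Sx.
have nR : (0 : R) < n%:R by rewrite ltr0n.
have Sn : (#|~: S| < n)%N.
  by rewrite -(ltr_nat R); apply: le_lt_trans SG _; rewrite gtr_pMl.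
have S0 := card_informed _ Sn.
have Sk := card_informedE S.
have xj := fraction_bound_gt0 j; have xj1 := fraction_bound_gt0 j.+1.
have b0 : 0 < kappa `^ (l - 1) by rewrite powR_gt0.
set b := kappa `^ (l - 1) in ab b0 hq1 *.
have [hu|hu] := leP (n%:R `^ (1 - alpha)) (#|~: S|%:R : R).
  have u0 : (0 : R) < #|~: S|%:R.
    by apply: lt_le_trans hu; rewrite powR_gt0.
  have hr : n%:R `^ (1 - alpha) <= (#|~: S|%:R : R) <= g * n%:R by rewrite hu.
  have := hs _ hr; have := hc _ hr; rewrite -Sk => hcov hsucc.
  set th : R := 1 - a / b in hq1.
  have th0 : 0 < th by rewrite subr_gt0 ltr_pdivrMr // mul1r.
  have D0 : 0 < n%:R * th * fraction_bound j.+1.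
    exact: (mulr_gt0 (mulr_gt0 nR th0) xj1).
  apply: (@le_trans _ _ ((#|~: S|%:R + #|~: S|%:R ^+ 2 *
      (c * (n%:R / #|~: S|%:R ^+ 2))) / (n%:R * th * fraction_bound j.+1) ^+ 2)).
    apply: round_chebyshev => //.
    - by rewrite mulr_ge0 // divr_ge0 // exprn_ge0.
    (* The mean is at most a fraction a/b of the next threshold; the remaining fraction [th] is the
       slack for the deviation. *)
    - have : #|~: S|%:R * (1 - success K #|S|) <=
          n%:R * fraction_bound j * (a * fraction_bound j `^ (l - 1)).
        apply: (@le_trans _ _
            (#|~: S|%:R * (a * (#|~: S|%:R / n%:R) `^ (l - 1)))).
          by apply: ler_wpM2l; rewrite ?(ltW u0).
        apply: ler_pM => //; first by rewrite mulr_ge0 // powR_ge0.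
        apply: ler_wpM2l => //; apply: ge0_ler_powR.
        + by rewrite subr_ge0 ltW.
        + by rewrite nnegrE divr_ge0.
        + by rewrite nnegrE ltW.
        + by rewrite ler_pdivrMr // mulrC.
      have <- : n%:R * (a / b) * fraction_bound j.+1 =
          n%:R * fraction_bound j * (a * fraction_bound j `^ (l - 1)).
        have l0 : 0 < l by exact: lt_trans ltr01 _.
        rewrite -fraction_boundS -[in LHS](mulr_powRB1 (ltW xj) l0).
        by rewrite -/b; field; rewrite gt_eqF.
      by rewrite /th; lra.
  apply: le_trans hq1.
  rewrite ler_pdivrMr ?exprn_gt0 //.
  (* The squares of u cancel in the covariance term, so the variance is at most (1 + c) n. *)
  rewrite (_ : _ + _ = #|~: S|%:R + c * n%:R); last by field; rewrite gt_eqF.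
  apply: (@le_trans _ _ ((1 + c) * n%:R)).
    by rewrite mulrDl mul1r lerD2r ler_nat ltnW.
  rewrite (_ : _ / _ * _ = (1 + c) * n%:R *
    (fraction_bound j.+1 / M) ^+ 2); last first.
    by field; rewrite !gt_eqF.
  rewrite ler_peMr ?mulr_ge0 ?addr_ge0 // exprn_ege1 // ler_pdivlMr // mul1r.
  exact: Mx.
have m0 : 0 < n%:R * fraction_bound j.+1 by exact: mulr_gt0.
apply: le_trans (round_markov K S _ S0 m0) _.
apply: le_trans hq2; rewrite ler_pdivrMr //.
apply: (@le_trans _ _ (#|~: S|%:R * n%:R `^ (- tau))).
  have [->|u0] := posnP #|~: S|; first by rewrite !mul0r.
  apply: ler_wpM2l => //; rewrite Sk; apply: he; rewrite ?ltW //.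
  by rewrite u0 /= subn1 -ltnS (ltn_predK Sn).
rewrite (_ : _ / _ * _ = n%:R * n%:R `^ (- tau) *
  (fraction_bound j.+1 / M)); last first.
  by field; rewrite gt_eqF.
apply: (@le_trans _ _ (n%:R * n%:R `^ (- tau))).
  by apply: ler_wpM2r; rewrite ?powR_ge0 // ler_nat ltnW.
rewrite ler_peMr ?mulr_ge0 ?powR_ge0 // ler_pdivlMr // mul1r.
exact: Mx.
Qed.

(** Reaching the last of the [J] thresholds uses up [q ^+ J], so that n (2q)^(J+t) / q^J remains. *)
Lemma thresholds_incomplete (n : nat) (K : rumor_process R n)
    (g alpha a c tau q M : R) (J t : nat) (S : {set 'I_n}) :
  (0 < n)%N -> g < 1 -> 0 <= a < kappa `^ (l - 1) -> 0 <= c ->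
  kappa * g <= expR (- lam) ->
  (forall u : nat, n%:R `^ (1 - alpha) <= u%:R <= g * n%:R ->
    1 - success K (n - u)%N <= a * (u%:R / n%:R) `^ (l - 1)) ->
  (forall u : nat, n%:R `^ (1 - alpha) <= u%:R <= g * n%:R ->
    (cov_number K (n - u)%N <= (c * (n%:R / u%:R ^+ 2))%:E)%E) ->
  (forall u : nat, (1 <= u <= n - 1)%N -> u%:R <= n%:R `^ (1 - alpha) ->
    1 - success K (n - u)%N <= n%:R `^ (- tau)) ->
  0 < M <= fraction_bound J -> 0 < q <= 1 ->
  (1 + c) / (n%:R * (1 - a / kappa `^ (l - 1)) ^+ 2 * M ^+ 2) <= q ->
  n%:R `^ (- tau) / M <= q ->
  n%:R `^ (- tau) <= q -> a * fraction_bound J `^ (l - 1) <= q ->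
  #|~: S|%:R <= g * n%:R ->
  incomplete_prob K (J + t) S <= n%:R * 2 ^+ J * (2 * q) ^+ t.
Proof.
move=> n0 g1 ab c0 kg hs hc he /andP[M0 MJ] /andP[q0 q1] hq1 hq2 hq3 hq4 SG.
have nR : (0 : R) < n%:R by rewrite ltr0n.
have qJ : 0 < q ^+ J by rewrite exprn_gt0.
rewrite -(ler_pM2r qJ).
rewrite (_ : n%:R * _ * _ * q ^+ J = n%:R * (2 * q) ^+ (J + t)); last first.
  by rewrite exprD !exprMn; ring.
apply: (@incomplete_prob_thresholds _ _ K (g * n%:R) q
  (fun d => n%:R * fraction_bound (J - d)) J) => //.
- by rewrite gtr_pMl.
- by rewrite ltW.
- move=> S' S'G S'0; rewrite subn0 => S'J.
  have S'n : (#|~: S'| < n)%N.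
    by rewrite -(ltr_nat R); apply: le_lt_trans S'G _; rewrite gtr_pMl.
  have Sk := card_informedE S'.
  rewrite Sk; have [hu|hu] := leP (n%:R `^ (1 - alpha)) (#|~: S'|%:R : R).
    apply: le_trans (hs _ _) _; first by rewrite hu.
    apply: le_trans hq4; case/andP: ab => a0 _.
    apply: ler_wpM2l => //; apply: ge0_ler_powR.
    + by rewrite subr_ge0 ltW.
    + by rewrite nnegrE divr_ge0.
    + by rewrite nnegrE ltW // fraction_bound_gt0.
    + by rewrite ler_pdivrMr // mulrC.
  apply: le_trans hq3; apply: he; rewrite ?ltW //.
  by rewrite S'0 /= subn1 -ltnS (ltn_predK S'n).
- move=> d S' dJ S'G S'J; have E : (J - d = (J - d.+1).+1)%N by rewrite subnSK.
  rewrite E; apply: (@thresholds_step _ _ g alpha a c tau q M) => //.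
  rewrite M0 /=; apply: le_trans MJ _.
  by apply: fraction_bound_anti; rewrite -E leq_subr.
(* The start lies below the threshold of index 0, because [g <= expR (- lam) / kappa]. *)
- rewrite subnn; apply: le_trans SG _; rewrite mulrC ler_pM2l //.
  by rewrite /fraction_bound expr0 mulr1 ler_pdivlMr // mulrC.
Qed.

End Thresholds.

(** * Choice of the constants and estimates for large n *)

Section Asymptotics.
Context {R : realType}.

Lemma near_le_powR (C e : R) : 0 < e -> \forall n \near \oo, C <= n%:R `^ e.
Proof.
move=> e0; near=> n.
have n1 : Num.max C 1 `^ e^-1 <= n%:R by near: n; exact: nbhs_infty_ger.
have C1 : 0 <= Num.max C 1 by rewrite le_max ler01 orbT.
apply: (@le_trans _ _ (Num.max C 1)); first by rewrite le_max lexx.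
rewrite -[leLHS](powRr1 C1) -[X in _ `^ X](@mulVf _ e) ?gt_eqF // powRrM.
by apply: ge0_ler_powR; rewrite ?nnegrE ?powR_ge0 // ltW.
Unshelve. all: end_near. Qed.

Lemma near_le_ln (C : R) : \forall n \near \oo, C <= ln n%:R.
Proof.
near=> n; have h : expR C <= n%:R by near: n; exact: nbhs_infty_ger.
by rewrite -(expRK C) ler_ln ?posrE ?expR_gt0 // (lt_le_trans _ h) ?expR_gt0.
Unshelve. all: end_near. Qed.

(** The inequality [ln y < y] at [y = ln n / (2 * A)] bounds the double logarithm using half of
    [ln n]; the other half absorbs the constants. *)
Lemma near_ln_ln_le (A C : R) : 0 < A ->
  \forall n \near \oo, A * ln (ln n%:R) + C <= ln n%:R.
Proof.
move=> A0; near=> n.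
have x0 : 1 <= ln (n%:R : R) by near: n; exact: near_le_ln.
have x1 : 2 * (A * ln (2 * A) + C) <= ln (n%:R : R).
  by near: n; exact: near_le_ln.
have x00 : 0 < ln (n%:R : R) by lra.
have A20 : 0 < 2 * A by rewrite mulr_gt0.
have : ln (ln n%:R / (2 * A)) < ln n%:R / (2 * A).
  by apply: ln_sublinear; rewrite divr_gt0.
rewrite ln_div ?posrE // ltrBlDr -(ltr_pM2l A0) => h.
have E : A * (ln n%:R / (2 * A) + ln (2 * A)) = ln n%:R / 2 + A * ln (2 * A).
  by field; rewrite gt_eqF.
lra.
Unshelve. all: end_near. Qed.

Lemma exists_kappa_lam (g l a : R) : 0 <= g < 1 -> 1 < l -> 0 <= a ->
  a * g `^ (l - 1) < 1 ->
  exists kappa lam : R,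
    [/\ 0 < kappa, 0 < lam, a < kappa `^ (l - 1) & kappa * g <= expR (- lam)].
Proof.
move=> /andP[g0 g1] l1 a0 hag.
have l10 : 0 < l - 1 by rewrite subr_gt0.
pose k0 := a `^ (l - 1)^-1.
have k00 : 0 <= k0 by exact: powR_ge0.
have k0a : k0 `^ (l - 1) = a by rewrite -powRrM mulVf ?gt_eqF // powRr1.
have k0g : k0 * g < 1.
  rewrite ltNge; apply/negP => h; move: hag; rewrite ltNge => /negP; apply.
  have E : 1 `^ (l - 1) = 1 :> R by rewrite powR1.
  rewrite -k0a -powRM // -[leLHS]E.
  by apply: ge0_ler_powR; rewrite ?nnegrE ?mulr_ge0 // ltW.
(* The value [k0] gives equality in [a < kappa^(l - 1)]. Since [g < 1], this increase keeps [k * g]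
   below 1; [lam] is then chosen so that [expR (- lam)] is the midpoint of [k * g] and 1. *)
pose k := k0 + (1 - k0 * g) / 2.
have kk0 : k0 < k by rewrite /k; lra.
have kpos : 0 < k by lra.
have kg : k * g < 1 by rewrite /k; nra.
have kg0 : 0 <= k * g by rewrite mulr_ge0 // ltW.
exists k, (- ln ((1 + k * g) / 2)); split => //.
- by rewrite oppr_gt0 ln_lt0 //; lra.
- by rewrite -{1}k0a; apply: gt0_ltr_powR; rewrite ?nnegrE // ltW.
- by rewrite opprK lnK ?posrE; lra.
Qed.

Lemma exists_log_ceil (l h : R) : 1 < l -> 1 <= h ->
  exists J : nat, h <= l ^+ J <= l * h /\ J%:R <= ln h / ln l + 1.
Proof.
move=> l1 h1; have l0 : 0 < l by exact: lt_trans ltr01 _.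
have h0 : 0 < h by lra.
have lnl : 0 < ln l by rewrite ln_gt0.
have v0 : 0 <= ln h / ln l by rewrite divr_ge0 ?ln_ge0 // ltW.
pose J := `|Num.ceil (ln h / ln l)|%N.
have JE : J%:R = (Num.ceil (ln h / ln l))%:~R :> R.
  by rewrite natr_absz ger0_norm // ceil_ge0; lra.
have J1 : ln h / ln l <= J%:R by rewrite JE ceil_ge.
have J2 : J%:R <= ln h / ln l + 1.
  by have := ceilB1_lt (ln h / ln l); rewrite intrB -JE; lra.
exists J; split => //; apply/andP; split.
- rewrite -ler_ln ?posrE ?exprn_gt0 // lnXn // -mulr_natl.
  by rewrite -ler_pdivrMr.
- rewrite -ler_ln ?posrE ?exprn_gt0 ?mulr_gt0 // lnXn // lnM ?posrE //.
  rewrite -mulr_natl; have := ler_wpM2r (ltW lnl) J2.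
  rewrite mulrDl divfK ?gt_eqF //.
  lra.
Qed.

Lemma near_incomplete (g alpha l a c : R) (hg : 0 <= g < 1) (hl : 1 < l)
    (ha : 0 <= a) (hc : 0 <= c) (hag : a * g `^ (l - 1) < 1)
    (K : forall n : nat, rumor_process R n)
    (hsucc : \forall n \near \oo, forall u : nat,
      n%:R `^ (1 - alpha) <= u%:R <= g * n%:R ->
      1 - success (K n) (n - u)%N <= a * (u%:R / n%:R) `^ (l - 1))
    (hcov : \forall n \near \oo, forall u : nat,
      n%:R `^ (1 - alpha) <= u%:R <= g * n%:R ->
      (cov_number (K n) (n - u)%N <= (c * (n%:R / u%:R ^+ 2))%:E)%E)
    (hend : exists2 tau : R, 0 < tau & \forall n \near \oo, forall u : nat,
      (1 <= u <= n - 1)%N -> u%:R <= n%:R `^ (1 - alpha) ->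
      1 - success (K n) (n - u)%N <= n%:R `^ (- tau)) :
  exists (C0 : nat) (delta : R), 0 < delta /\ \forall n \near \oo,
    exists J : nat, J%:R <= ln (ln n%:R) / ln l + C0%:R /\
      forall t (S : {set 'I_n}), #|~: S|%:R <= g * n%:R ->
        incomplete_prob (K n) (J + t) S <= n%:R `^ (2 - delta * t%:R).
Proof.
have [kappa [lam [kappa0 lam0 ak kg]]] := exists_kappa_lam _ _ _ hg hl ha hag.
case: hend => tau tau0 hend.
have l0 : 0 < l by exact: lt_trans ltr01 _.
have l10 : 0 < l - 1 by lra.
have lnl : 0 < ln l by rewrite ln_gt0.
(* In the Chebyshev rounds the failure probability is O(n^(2 lgam - 1)). While
   u < n^(1 - alpha) only 1 - p <= n^(-tau) is known, and Markov's inequality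
   gives O(n^(lgam - tau)). *)
pose lgam := Num.min 4^-1 (tau / 2).
have lgam0 : 0 < lgam by rewrite lt_min; apply/andP; split; lra.
have [lgam4 lgamt] : lgam <= 4^-1 /\ lgam <= tau / 2.
  by split; rewrite ge_min lexx ?orbT.
(* Rounding [J] up puts lam l^J between gam ln n and l gam ln n, hence the quotient by [l]. *)
pose gam := lgam / l.
have gam0 : 0 < gam by rewrite divr_gt0.
(* The three bounds serve the Chebyshev rounds, the Markov rounds and the success probability below
   the last threshold, with n^(1/4) and n^(tau/4) set aside for constants. *)
pose eps := Num.min 4^-1 (Num.min (tau / 4) (gam * (l - 1))).
have gl0 : 0 < gam * (l - 1) by rewrite mulr_gt0.
have eps0 : 0 < eps by rewrite !lt_min gl0 andbT; apply/andP; split; lra.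
have [eps4 [epst epsg]] : eps <= 4^-1 /\ eps <= tau / 4 /\ eps <= gam * (l - 1).
  by split; [|split]; rewrite !ge_min lexx ?orbT.
pose B := ln (gam / lam) / ln l + 1.
pose C0 := (Num.truncn B).+1.
have BC0 : B <= C0%:R by rewrite ltW // truncnS_gt.
pose th : R := 1 - a / kappa `^ (l - 1).
have b0 : 0 < kappa `^ (l - 1) by rewrite powR_gt0.
have th0 : 0 < th by rewrite subr_gt0 ltr_pdivrMr // mul1r.
have ln2 : 0 < ln 2 :> R by rewrite ln_gt0 // ltr1n.
(* Half of [eps] is given up to absorb the 2 in [2 * q]. *)
exists C0, (eps / 2); split; first by rewrite divr_gt0.
near=> n.
have n1 : (1 : R) <= n%:R by near: n; exact: nbhs_infty_ger.
have nR : (0 : R) < n%:R by lra.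
have nD (x y : R) : n%:R `^ x * n%:R `^ y = n%:R `^ (x + y) :> R.
  by rewrite powRD // (gt_eqF nR) implybT.
have lnn1 : lam / gam <= ln (n%:R : R) by near: n; exact: near_le_ln.
have lnn0 : 0 < ln (n%:R : R) by apply: lt_le_trans lnn1; rewrite divr_gt0.
have h1 : 1 <= gam * ln n%:R / lam.
  by rewrite ler_pdivlMr // mul1r mulrC -ler_pdivrMr.
have [J [/andP[Jlo Jhi] JB]] := exists_log_ceil _ _ hl h1.
have JL : J%:R <= ln (ln n%:R) / ln l + C0%:R.
  apply: le_trans JB _; rewrite mulrAC lnM ?posrE ?divr_gt0 // mulrDl.
  by move: BC0; rewrite /B; lra.
exists J; split=> // t S SG.
have pownE (x : R) : n%:R `^ x = expR (x * ln n%:R) by rewrite /powR gt_eqF.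
have xlo : n%:R `^ (- lgam) / kappa <= fraction_bound kappa lam l J.
  rewrite ler_pM2r ?invr_gt0 // pownE ler_expR mulNr lerN2.
  apply: le_trans (ler_wpM2l (ltW lam0) Jhi) _.
  rewrite le_eqVlt; apply/orP; left; apply/eqP.
  by rewrite /gam; field; rewrite !gt_eqF.
have xhi : fraction_bound kappa lam l J <= n%:R `^ (- gam) / kappa.
  rewrite ler_pM2r ?invr_gt0 // pownE ler_expR mulNr lerN2.
  by rewrite [leRHS]mulrC -ler_pdivrMr.
have q0 : 0 < n%:R `^ (- eps) :> R by rewrite powR_gt0.
have two : 2 <= n%:R `^ (eps / 2) :> R.
  by near: n; apply: near_le_powR; rewrite divr_gt0.
apply: (@le_trans _ _ (n%:R * 2 ^+ J * (2 * n%:R `^ (- eps)) ^+ t)).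
  apply: (@thresholds_incomplete _ kappa lam l kappa0 lam0 hl n (K n) g alpha a
    c tau _ (n%:R `^ (- lgam) / kappa)) => //.
  - by rewrite -(ltr_nat R).
  - by case/andP: hg.
  - by rewrite ha.
  - by near: n.
  - by near: n.
  - by near: n.
  - by rewrite xlo andbT divr_gt0 // powR_gt0.
  - by rewrite q0 /= -[leRHS](powRr0 n%:R); apply: ler_powR => //; lra.
  - have hC : (1 + c) * kappa ^+ 2 / th ^+ 2 <= n%:R `^ 4^-1.
      by near: n; apply: near_le_powR; rewrite invr_gt0.
    rewrite -/th; apply: (@le_trans _ _
      (n%:R `^ 4^-1 * n%:R `^ (2 * lgam - 1))); last first.
      by rewrite nD; apply: ler_powR => //; lra.
    apply: le_trans (ler_wpM2r (powR_ge0 _ _) hC).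
    rewrite le_eqVlt; apply/orP; left; apply/eqP.
    rewrite -nD (mulrC 2) powRrM !powRN powRr1 ?(ltW nR) //.
    rewrite powR_mulrn ?powR_ge0 //.
    by field; rewrite !gt_eqF // powR_gt0.
  - have hC : kappa <= n%:R `^ (tau / 4).
      by near: n; apply: near_le_powR; rewrite divr_gt0.
    apply: (@le_trans _ _ (n%:R `^ (tau / 4) * n%:R `^ (lgam - tau))); last first.
      by rewrite nD; apply: ler_powR => //; lra.
    apply: le_trans (ler_wpM2r (powR_ge0 _ _) hC).
    rewrite le_eqVlt; apply/orP; left; apply/eqP.
    rewrite -nD powRN.
    by rewrite (powRN _ lgam); field; rewrite !gt_eqF // powR_gt0.
  - by apply: ler_powR => //; lra.
  - apply: (@le_trans _ _ (a * (n%:R `^ (- gam) / kappa) `^ (l - 1))).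
      apply: ler_wpM2l => //; apply: ge0_ler_powR; rewrite ?nnegrE ?(ltW l10) //.
      + by rewrite ltW // fraction_bound_gt0.
      + by rewrite divr_ge0 ?powR_ge0 // ltW.
    rewrite powRM ?powR_ge0 ?invr_ge0 ?(ltW kappa0) // -powRrM.
    rewrite -(powR_inv1 (ltW kappa0)) -powRrM mulN1r powRN.
    rewrite mulrCA -[leRHS]mulr1; apply: ler_pM; rewrite ?powR_ge0 //.
    + by rewrite divr_ge0 // powR_ge0.
    + by apply: ler_powR => //; lra.
    + by rewrite ler_pdivrMr // mul1r ltW.
(* As [J] is O(ln ln n), the factor [2 ^+ J] is below n; with the factor n in front this explains
   the exponent 2. *)
have twoJ : 2 ^+ J <= n%:R :> R.
  rewrite -ler_ln ?posrE ?exprn_gt0 // lnXn // -[leLHS]mulr_natl.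
  apply: (@le_trans _ _ (ln 2 / ln l * ln (ln n%:R) + C0%:R * ln 2)).
    apply: le_trans (ler_wpM2r (ltW ln2) JL) _.
    by rewrite mulrDl mulrAC (mulrC _ (ln 2)) mulrAC.
  by near: n; apply: near_ln_ln_le; rewrite divr_gt0.
rewrite -nD -mulNr powRrM powR_mulrn ?powR_ge0 //.
apply: ler_pM; rewrite ?mulr_ge0 ?exprn_ge0 ?mulr_ge0 ?powR_ge0 //.
  by rewrite powR_mulrn // expr2; apply: ler_wpM2l.
apply: lerXn2r; rewrite ?nnegrE ?mulr_ge0 ?powR_ge0 //.
apply: le_trans (ler_wpM2r (powR_ge0 _ _) two) _.
by rewrite nD; apply: ler_powR => //; lra.
Unshelve. all: end_near. Qed.

End Asymptotics.

(** * Conclusion: expectation and tail of the spread time *)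

Lemma card_uninformed_natceil (R : realType) (n : nat) (g : R)
    (S : {set 'I_n}) :
  g <= 1 -> #|S| = natceil ((1 - g) * n%:R) -> #|~: S|%:R <= g * n%:R.
Proof.
move=> g1 Sk; have := cardsC S; rewrite card_ord => Sn.
have h0 : 0 <= (1 - g) * n%:R by rewrite mulr_ge0 // subr_ge0.
have h : (1 - g) * n%:R <= #|S|%:R.
  rewrite Sk /natceil natr_absz ger0_norm ?ceil_ge //.
  by rewrite -(ler_int R); apply: le_trans h0 (ceil_ge _).
have : #|S|%:R + #|~: S|%:R = n%:R :> R by rewrite -natrD Sn.
by lra.
Qed.

Lemma nneseries_geometric_half (R : realType) (u : nat -> \bar R) :
  (forall j, 0 <= u j <= (2^-1 ^+ j : R)%:E)%E ->
  (\sum_(0 <= j <oo) u j <= 2%:E)%E.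
Proof.
move=> hu; apply: le_trans (epsilon_trick0 xpredT (ler0n R 2)).
apply: lee_nneseries => [j _|j _]; first by case/andP: (hu j).
case/andP: (hu j) => _ /le_trans; apply; rewrite lee_fin.
by rewrite natrX exprS invfM mulrA divff // mul1r exprVn.
Qed.

Theorem theorem43 (R : realType) (g alpha l a c : R)
    (hg : 0 <= g < 1) (halpha : 0 <= alpha <= 1) (hl : 1 < l)
    (ha : 0 <= a) (hc : 0 <= c) (hag : a * g `^ (l - 1) < 1)
    (K : forall n : nat, rumor_process R n)
    (hsucc : \forall n \near \oo, forall u : nat,
      n%:R `^ (1 - alpha) <= u%:R <= g * n%:R ->
      1 - success (K n) (n - u)%N <= a * (u%:R / n%:R) `^ (l - 1))
    (hcov : \forall n \near \oo, forall u : nat,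
      n%:R `^ (1 - alpha) <= u%:R <= g * n%:R ->
      (cov_number (K n) (n - u)%N <= (c * (n%:R / u%:R ^+ 2))%:E)%E)
    (hend : exists2 tau : R, 0 < tau & \forall n \near \oo, forall u : nat,
      (1 <= u <= n - 1)%N -> u%:R <= n%:R `^ (1 - alpha) ->
      1 - success (K n) (n - u)%N <= n%:R `^ (- tau)) :
  (exists C : R, \forall n \near \oo,
    forall (d : measure_display) (Omega : measurableType d)
      (P : probability Omega R) (I : nat -> Omega -> {set 'I_n}),
    run_from (K n) (natceil ((1 - g) * n%:R)) P I ->
    (\int[P]_w spread_time R I n w <= (ln (ln n%:R) / ln l + C)%:E)%E)
  /\
  (exists A' alpha' : R, [/\ 0 < A', 0 < alpha' &
    exists C : R, \forall n \near \oo,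
    forall (d : measure_display) (Omega : measurableType d)
      (P : probability Omega R) (I : nat -> Omega -> {set 'I_n}),
    run_from (K n) (natceil ((1 - g) * n%:R)) P I ->
    forall r : nat,
    (P [set w | (ln (ln n%:R) / ln l + r%:R)%:E <= spread_time R I n w]
      <= (C * n%:R `^ (- (alpha' * r%:R) + A'))%:E)%E]).

Proof.
case: (near_incomplete g alpha l a c hg hl ha hc hag K hsucc hcov hend)
  => C0 [delta [delta0 hmain]].
have lnl : 0 < ln l by rewrite ln_gt0.
have g1 : g <= 1 by case/andP: hg => _ /ltW.
split.
  (* These extra rounds cancel n^2, so the probabilities after round [J + s0] are at most n^(- delta
     j) <= 2^(-j) and sum to at most 2; earlier ones are bounded by 1. *)
  pose s0 := (Num.truncn (2 / delta)).+1.
  have hs0 : 2 <= delta * s0%:R.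
    by rewrite mulrC -ler_pdivrMr // ltW // truncnS_gt.
  exists (C0%:R + s0%:R + 2); near=> n.
  move=> d Omega P I HI; rewrite (mean_spread_time HI).
  have n1 : (1 : R) <= n%:R by near: n; exact: nbhs_infty_ger.
  have two : 2 <= n%:R `^ delta by near: n; exact: near_le_powR.
  have [J [JL hJ]] : exists J : nat, J%:R <= ln (ln n%:R) / ln l + C0%:R /\
      forall t (S : {set 'I_n}), #|~: S|%:R <= g * n%:R ->
        incomplete_prob (K n) (J + t) S <= n%:R `^ (2 - delta * t%:R).
    by near: n.
  rewrite (nneseries_split _ (J + s0)) // add0n.
  rewrite -nneseries_addn //.
  have head : (\sum_(0 <= t < J + s0) P [set w | (0 < #|~: I t w|)%N]
      <= ((J + s0)%:R : R)%:E)%E.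
    apply: (@le_trans _ _ (\sum_(0 <= t < J + s0) (1 : R)%:E)%E).
      by apply: lee_sum => t _; apply: probability_le1;
         exact: (measurable_informed HI t (fun S => (0 < #|~: S|)%N)).
    by rewrite sumEFin big_mkord sumr_const card_ord.
  have tail : (\sum_(0 <= j <oo) P [set w | (0 < #|~: I (j + (J + s0))%N w|)%N]
      <= 2%:E)%E.
    apply: nneseries_geometric_half => j; rewrite measure_ge0 /=.
    apply: (incomplete_le HI) => S Sk; rewrite addnC -addnA.
    apply: le_trans (hJ _ _ (card_uninformed_natceil _ _ _ _ g1 Sk)) _.
    rewrite natrD mulrDr opprD addrA.
    apply: (@le_trans _ _ (n%:R `^ (- (delta * j%:R)))).
      by apply: ler_powR => //; lra.
    rewrite powRN powRrM powR_mulrn ?powR_ge0 // -exprVn.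
    apply: lerXn2r; rewrite ?nnegrE ?invr_ge0 ?powR_ge0 //.
    by rewrite lef_pV2 ?posrE // (lt_le_trans _ two).
  apply: le_trans (leeD head tail) _.
  by rewrite -EFinD lee_fin natrD; lra.
(* Only [r - C0 - 1] rounds beyond [J] are exploited; this shift of [r] goes into [A']. *)
exists (2 + delta * (C0%:R + 1)), delta.
have C0R : (0 : R) <= C0%:R by [].
have dC : 0 <= delta * (C0%:R + 1) by rewrite mulr_ge0 ?ltW // addr_ge0.
split => //; first by lra.
exists 1; near=> n.
move=> d Omega P I HI r; rewrite mul1r.
have n1 : (1 : R) <= n%:R by near: n; exact: nbhs_infty_ger.
have [J [JL hJ]] : exists J : nat, J%:R <= ln (ln n%:R) / ln l + C0%:R /\
    forall t (S : {set 'I_n}), #|~: S|%:R <= g * n%:R ->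
      incomplete_prob (K n) (J + t) S <= n%:R `^ (2 - delta * t%:R).
  by near: n.
(* For small [r] the exponent is nonnegative and the bound is at least 1. *)
have [rC|rC] := leqP r C0.
  apply: (@le_trans _ _ 1%E).
    apply: probability_le1; rewrite -[X in measurable X]setTI.
    exact: (emeasurable_fun_c_infty measurableT (measurable_spread_time HI)).
  rewrite lee_fin -[leLHS](powRr0 n%:R); apply: ler_powR => //.
  have : delta * r%:R <= delta * C0%:R by rewrite ler_pM2l // ler_nat.
  lra.
(* The extra 1 makes [J + s] strictly smaller than log_l ln n + r, as the tail bound requires. *)
pose s := (r - C0.+1)%N.
have rE : r%:R = s%:R + C0%:R + 1 :> R.
  by rewrite -[r](subnK rC) -/s natrD -natr1; ring.
apply: le_trans (spread_time_tail HI (J + s) _ _) _.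
  by rewrite lte_fin natrD; lra.
apply: (incomplete_le HI) => S Sk.
apply: le_trans (hJ _ _ (card_uninformed_natceil _ _ _ _ g1 Sk)) _.
by apply: ler_powR => //; rewrite rE; lra.
Unshelve. all: end_near. Qed.
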